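(* For all $n \ge 2$, $$|S_n(132, 54213, 2341)| = 3F_{n+5} - 2\binom{n+1}{3} - 4\binom{n+1}{2} - 3\binom{n+1}{1} - 14.$$ Moreover, the generating function $f(x) = \sum_{n=0}^\infty |S_n(132, 54213, 2341)|\, x^n$ is given by $$f(x) = \frac{x^7 - 3x^5 + x^4 + 2x^3 - 6x^2 + 4x - 1}{(x^2 + x - 1)(1 - x)^4}.$$
   Context: Permutations of $[n]$ are written in one-line notation, and $S_n$ denotes the set of them. A permutation $\pi\in S_n$ contains $\sigma\in S_m$ if there are indices $i_1<\dots<i_m$ such that for all $a,b$, $\pi(i_a)<\pi(i_b)$ iff $\sigma(a)<\sigma(b)$; otherwise $\pi$ avoids $\sigma$. For a set $R$ of permutations, $S_n(R)$ is the set of $\pi\in S_n$ avoiding every element of $R$; $S_0(R)$ consists of the empty permutation only. $F_n$ denotes the Fibonacci numbers with $F_0=0$, $F_1=F_2=1$, $F_n=F_{n-1}+F_{n-2}$. *)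

(* Defs.v *)
From mathcomp Require Import all_boot all_order all_algebra all_fingroup.

Set Implicit Arguments.
Unset Strict Implicit.
Unset Printing Implicit Defensive.

Import GRing.Theory.

(* Elements of 'S_n permute {0, ..., n-1}; words are written with the usual
   letters 1, ..., n, hence the shift by one. *)
Section OneLine.
Variables (w : seq nat) (perm_w : perm_eq w (iota 1 (size w))).

Lemma oneline_mem (i : 'I_(size w)) : 0 < nth 0 w i <= size w.
Proof.
have: nth 0 w i \in iota 1 (size w) by rewrite -(perm_mem perm_w) mem_nth.
by rewrite mem_iota add1n ltnS.
Qed.

Lemma oneline_bound (i : 'I_(size w)) : (nth 0 w i).-1 < size w.
Proof. by have /andP[w_gt0 w_le] := oneline_mem i; rewrite prednK. Qed.

Lemma oneline_inj : injective (fun i => Ordinal (oneline_bound i)).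
Proof.
move=> i j /(congr1 val) /= eq_ij; apply/val_inj/eqP => /=.
have uniq_w : uniq w by rewrite (perm_uniq perm_w) iota_uniq.
rewrite -(nth_uniq 0 (ltn_ord i) (ltn_ord j) uniq_w).
have /andP[wi_gt0 _] := oneline_mem i; have /andP[wj_gt0 _] := oneline_mem j.
by rewrite -(prednK wi_gt0) -(prednK wj_gt0) eq_ij.
Qed.

Definition oneline : 'S_(size w) := perm oneline_inj.

Lemma onelineE i : (oneline i).+1 = nth 0 w i.
Proof. by rewrite permE /= prednK //; have /andP[] := oneline_mem i. Qed.

End OneLine.

Definition contains n m (p : 'S_n) (s : 'S_m) : bool :=
  [exists f : {ffun 'I_m -> 'I_n},
     [forall a : 'I_m, forall b : 'I_m, (a < b) ==> (f a < f b)] &&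
     [forall a : 'I_m, forall b : 'I_m, (p (f a) < p (f b)) == (s a < s b)]].

Definition pattern := {m : nat & 'S_m}.

Definition pat (w : seq nat) (perm_w : perm_eq w (iota 1 (size w))) : pattern :=
  Tagged (fun m => 'S_m) (oneline perm_w).

Definition avoiders n (R : seq pattern) : {set 'S_n} :=
  [set p | all (fun s : pattern => ~~ contains p (tagged s)) R].

Definition pat132 : pattern := @pat [:: 1; 3; 2] isT.
Definition pat54213 : pattern := @pat [:: 5; 4; 2; 1; 3] isT.
Definition pat2341 : pattern := @pat [:: 2; 3; 4; 1] isT.

Fixpoint fib (n : nat) : nat :=
  if n is n'.+1 then (if n' is n''.+1 then fib n' + fib n'' else 1) else 0.

Local Open Scope ring_scope.

(* Formal power series over R, as sequences of coefficients. *)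
Section FormalPowerSeries.
Variable R : comUnitRingType.

Definition fps := nat -> R.

Definition fps_mul (f g : fps) : fps :=
  fun n => \sum_(i < n.+1) f i * g (n - i)%N.

Definition fps_of_poly (p : {poly R}) : fps := fun n => p`_n.

(* The first n coefficients of the inverse of q, solved for one after the
   other from q * q^-1 = 1. *)
Fixpoint fps_inv_seq (q : fps) (n : nat) : seq R :=
  if n is k.+1 then
    let s := fps_inv_seq q k in
    rcons s ((q 0%N)^-1 * ((k == 0%N)%:R - \sum_(i < k) q (k - i)%N * s`_i))
  else [::].

(* Meaningful only when the constant coefficient q 0 is a unit: see fps_mulV. *)
Definition fps_inv (q : fps) : fps := fun n => (fps_inv_seq q n.+1)`_n.

Definition fps_div (f g : fps) : fps := fps_mul f (fps_inv g).

Lemma size_fps_inv_seq q n : size (fps_inv_seq q n) = n.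
Proof. by elim: n => //= n IHn; rewrite size_rcons IHn. Qed.

Lemma nth_fps_inv_seq q n i : (i < n)%N -> (fps_inv_seq q n)`_i = fps_inv q i.
Proof.
elim: n => // n IHn; rewrite ltnS leq_eqVlt => /predU1P[-> // | lt_in].
by rewrite /= nth_rcons size_fps_inv_seq lt_in IHn.
Qed.

Lemma fps_mulV (q : fps) :
  q 0%N \is a GRing.unit -> fps_mul q (fps_inv q) =1 fps_of_poly 1.
Proof.
move=> Uq n; rewrite /fps_mul /fps_of_poly coef1 (reindex_inj rev_ord_inj) /=.
rewrite big_ord_recr /= subnn subn0.
under eq_bigr => i _ do rewrite subSS subKn ?(ltnW (ltn_ord i)) //.
rewrite {2}/fps_inv /= nth_rcons size_fps_inv_seq ltnn eqxx mulVKr //.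
under [X in _ + (_ - X)]eq_bigr => i _ do rewrite nth_fps_inv_seq //.
by rewrite addrC subrK.
Qed.

End FormalPowerSeries.

(* Main.v *)
(* A 132-avoiding permutation is L n R with every letter of L above every letter
   of R.  If R is nonempty, avoiding 2341 forces L to be decreasing, so only |L|
   and R matter: the prefix L n supplies the "5" of 54213, and also the "54" once
   |L| >= 2, hence R must avoid 4213 when |L| <= 1 and 213 otherwise.  If R is
   empty, n plays no role in any of the patterns.  The same analysis applies with
   54213 replaced by 4213 and by 213 (where n, if last, can be the "3" of 213, so
   that L is then increasing), which gives the linear recurrences
     a(n+1) = a(n) + b(n) + b(n-1) + c(1) + ... + c(n-2),
     b(n+1) = b(n) + c(1) + ... + c(n),
     c(n+1) = 1 + c(n) + c(n-1),
   where only terms of positive index occur in the sums; a, b and c count the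
   permutations avoiding 132, 2341 and, respectively, 54213, 4213 and 213.  Thus
   c(n) = F(n+2) - 1, and b and a follow by summation. *)
Require Import Defs.
From mathcomp Require Import all_boot all_order all_algebra all_fingroup.
From mathcomp Require Import zify ring lra.

Set Implicit Arguments.
Unset Strict Implicit.
Unset Printing Implicit Defensive.

Import Order.TTheory GRing.Theory Num.Theory.

(** * Pattern occurrence in words *)

Section Subsequences.
Variable T : eqType.
Implicit Types (s t u v w : seq T).

(** An explicit list keeps [occurs] computable, so that counts for the smallest lengths follow by
    evaluation. *)
Fixpoint subseqs w : seq (seq T) :=
  if w is x :: w' then [seq x :: t | t <- subseqs w'] ++ subseqs w'
  else [:: [::]].

Lemma mem_subseqs t w : (t \in subseqs w) = subseq t w.
Proof.
elim: w t => [|x w IHw] t /=; first by rewrite inE.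
rewrite mem_cat IHw; case: t => [|y t]; first by rewrite !sub0seq orbT.
have [<-|neq_yx] := eqVneq y x.
  rewrite mem_map ?IHw; last by move=> ? ? [].
  apply/orP/idP => [[//|]|]; last by left.
  exact/subseq_trans/subseq_cons.
by rewrite [X in X || _](_ : _ = false) //; apply/mapP => -[z _ [/eqP]];
   rewrite (negPf neq_yx).
Qed.

Lemma subseq_cat_split t u v :
  subseq t (u ++ v) -> exists i, subseq (take i t) u /\ subseq (drop i t) v.
Proof.
elim: u t => [|x u IHu] t /=; first by exists 0; rewrite take0 drop0.
case: t => [|y t]; first by exists 0; rewrite take0 drop0 !sub0seq.
have [->|neq_yx] := eqVneq y x => /IHu [i [tu tv]].
  by exists i.+1; rewrite /= eqxx.
by exists i; split=> //; case: i tu {tv} => //= i; rewrite (negPf neq_yx).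
Qed.

End Subsequences.

(** Here [s] is the pattern and [t] the candidate. Only comparisons between letters matter, so
    patterns on 1, 2, ... can be tested against words on 0, 1, .... *)
Definition order_iso (s t : seq nat) : bool :=
  (size t == size s) &&
  all (fun i => all (fun j => (nth 0 t i < nth 0 t j) == (nth 0 s i < nth 0 s j))
                    (iota 0 (size s))) (iota 0 (size s)).

Definition occurs (s w : seq nat) : bool := has (order_iso s) (subseqs w).

Lemma occursP s w :
  reflect (exists2 t, subseq t w & order_iso s t) (occurs s w).
Proof.
by apply: (iffP hasP) => -[t]; exists t; rewrite // ?mem_subseqs // -mem_subseqs.
Qed.

Lemma occurs_subseq s u w : subseq u w -> occurs s u -> occurs s w.
Proof.
move=> uw /occursP[t tu st]; apply/occursP; exists t => //.
exact: subseq_trans uw.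
Qed.

Lemma occurs132P w :
  reflect (exists x y z, [/\ subseq [:: x; y; z] w, x < z & z < y])
          (occurs [:: 1; 3; 2] w).
Proof.
apply: (iffP (occursP _ _)) => [[t]|[x [y [z [xyz xz zy]]]]].
  case: t => [|x [|y [|z [|? ?]]]] // tw; rewrite /order_iso /= => H.
  by exists x, y, z; split=> //; lia.
by exists [:: x; y; z] => //; rewrite /order_iso /=; lia.
Qed.

Lemma occurs213P w :
  reflect (exists x y z, [/\ subseq [:: x; y; z] w, y < x & x < z])
          (occurs [:: 2; 1; 3] w).
Proof.
apply: (iffP (occursP _ _)) => [[t]|[x [y [z [xyz yx xz]]]]].
  case: t => [|x [|y [|z [|? ?]]]] // tw; rewrite /order_iso /= => H.
  by exists x, y, z; split=> //; lia.
by exists [:: x; y; z] => //; rewrite /order_iso /=; lia.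
Qed.

Lemma occurs2341P w :
  reflect (exists x y z t, [/\ subseq [:: x; y; z; t] w, t < x, x < y & y < z])
          (occurs [:: 2; 3; 4; 1] w).
Proof.
apply: (iffP (occursP _ _)) => [[u]|[x [y [z [t [xyzt tx xy yz]]]]]].
  case: u => [|x [|y [|z [|t [|? ?]]]]] // uw; rewrite /order_iso /= => H.
  by exists x, y, z, t; split=> //; lia.
by exists [:: x; y; z; t] => //; rewrite /order_iso /=; lia.
Qed.

Lemma occurs4213P w :
  reflect (exists x y z t, [/\ subseq [:: x; y; z; t] w, z < y, y < t & t < x])
          (occurs [:: 4; 2; 1; 3] w).
Proof.
apply: (iffP (occursP _ _)) => [[u]|[x [y [z [t [xyzt tx xy yz]]]]]].
  case: u => [|x [|y [|z [|t [|? ?]]]]] // uw; rewrite /order_iso /= => H.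
  by exists x, y, z, t; split=> //; lia.
by exists [:: x; y; z; t] => //; rewrite /order_iso /=; lia.
Qed.

Lemma occurs54213P w :
  reflect (exists v x y z t,
             [/\ subseq [:: v; x; y; z; t] w, z < y, y < t, t < x & x < v])
          (occurs [:: 5; 4; 2; 1; 3] w).
Proof.
apply: (iffP (occursP _ _)) => [[u]|[v [x [y [z [t [vxyzt ? ? ? ?]]]]]]].
  case: u => [|v [|x [|y [|z [|t [|? ?]]]]]] // uw; rewrite /order_iso /= => H.
  by exists v, x, y, z, t; split=> //; lia.
by exists [:: v; x; y; z; t] => //; rewrite /order_iso /=; lia.
Qed.

(** The final [n] could only play the last letter of [s]; but the letter of [s] at position [i] is
    larger than that one, and no letter of [l] exceeds [n]. *)
Lemma occurs_rcons_max s i l n :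
  {in l, forall x, x < n} -> i < size s -> last 0 s < nth 0 s i ->
  occurs s (rcons l n) = occurs s l.
Proof.
move=> l_lt i_s s_i; apply/idP/idP; last exact/occurs_subseq/subseq_rcons.
move=> /occursP[t t_ln st]; apply/occursP; exists t => //.
move: t_ln; rewrite -cats1 => /subseq_cat_split[j [t_l]].
move E : (drop j t) => [|x [|y t']] t_n; last first.
- by move: (size_subseq t_n); rewrite /=; lia.
- move: t_n; rewrite sub1seq inE => /eqP xn.
  move: st => /andP[/eqP size_t /allP /(_ (size s).-1)].
  rewrite mem_iota => /(_ ltac:(lia)) /allP /(_ i).
  rewrite mem_iota nth_last s_i => /(_ i_s) /eqP; rewrite -{1}size_t nth_last.
  rewrite -{1}(cat_take_drop j t) E last_cat /= xn.
  have: nth 0 t i \in t by rewrite mem_nth ?size_t.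
  rewrite -{2}(cat_take_drop j t) E mem_cat inE xn.
  by move=> /orP[/(mem_subseq t_l)/l_lt|/eqP]; lia.
by rewrite -[t](cat_take_drop j) E cats0.
Qed.

(** * Occurrences after a decreasing prefix and the maximum *)

Section DecreasingPrefix.
Variables (m k : nat) (r : seq nat).
Hypothesis r_lt : {in r, forall x, x < m}.

Let w := rev (iota m k) ++ (m + k) :: r.

Lemma subseq_rev_iota t :
  subseq t (rev (iota m k)) ->
  [&& all (fun x => m <= x < m + k) t, sorted gtn t & size t <= k].
Proof.
move=> tl; apply/and3P; split.
- by apply/allP => x /(mem_subseq tl); rewrite mem_rev mem_iota.
- by apply: subseq_sorted tl _; [exact: rev_trans ltn_trans | rewrite rev_sorted iota_ltn_sorted].
- by have := size_subseq tl; rewrite size_rev size_iota.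
Qed.

Lemma subseq_rev_iota_start : 1 < k -> subseq [:: m.+1; m] (rev (iota m k)).
Proof.
case: k => [|[|j]] // _.
have -> : iota m j.+2 = [:: m; m.+1] ++ iota m.+2 j by [].
by rewrite rev_cat suffix_subseq.
Qed.

Lemma subseq_lt t : subseq t r -> all (fun x => x < m) t.
Proof. by move=> tr; apply/allP => x /(mem_subseq tr)/r_lt. Qed.

Lemma subseq_suffix : subseq r w.
Proof. exact: subseq_trans (subseq_cons _ _) (suffix_subseq _ _). Qed.

(** Cases on the number [i] of letters of the occurrence lying in the prefix (patterns have at most
    five letters), then on whether the next letter is the maximum. Range and order constraints
    become hypotheses for [lia]. *)
Ltac split_occurrence H :=
  let i := fresh "i" in
  move/subseq_cat_split: H => [i [+ +]];
  case: i => [|[|[|[|[|i]]]]] /=;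
  move=> /subseq_rev_iota /= ?;
  try case: eqP => ?; move=> H;
  try have /= ? := subseq_lt H.

Lemma occurs132_prefix : occurs [:: 1; 3; 2] w = occurs [:: 1; 3; 2] r.
Proof.
apply/idP/idP; last exact/occurs_subseq/subseq_suffix.
move=> /occurs132P[x [y [z [H xz zy]]]]; apply/occurs132P.
split_occurrence H; try (exfalso; lia); by exists x, y, z.
Qed.

Lemma occurs2341_prefix : occurs [:: 2; 3; 4; 1] w = occurs [:: 2; 3; 4; 1] r.
Proof.
apply/idP/idP; last exact/occurs_subseq/subseq_suffix.
move=> /occurs2341P[x [y [z [t [H tx xy yz]]]]]; apply/occurs2341P.
split_occurrence H; try (exfalso; lia); by exists x, y, z, t.
Qed.

(** For [k > 1] the last two prefix letters [m.+1], [m] and the maximum form 213. For [k <= 1]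
    nothing before [r] can play the 2: a smaller letter after it lies in [r], and then no larger one
    follows. *)
Lemma occurs213_prefix :
  occurs [:: 2; 1; 3] w = (1 < k) || occurs [:: 2; 1; 3] r.
Proof.
apply/idP/orP => [/occurs213P[x [y [z [H yx xz]]]]|].
  have [|k_le1] := ltnP 1 k; [by left | right; apply/occurs213P].
  by split_occurrence H; try (exfalso; lia); exists x, y, z.
case=> [k_gt1|]; last exact/occurs_subseq/subseq_suffix.
apply/occurs213P; exists m.+1, m, (m + k); split; [|lia..].
rewrite /w -[[:: _; _; _]]/([:: m.+1; m] ++ [:: m + k]).
apply: cat_subseq; last by rewrite /= eqxx sub0seq.
exact: subseq_rev_iota_start.
Qed.

(** The letter playing 3 is neither the maximum nor in the decreasing prefix, so it lies in [r]; the
    letters 2 and 1 are below it, hence also in [r]. Conversely the maximum plays 4. *)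
Lemma occurs4213_prefix :
  occurs [:: 4; 2; 1; 3] w = occurs [:: 2; 1; 3] r.
Proof.
apply/occurs4213P/occurs213P => [[x [y [z [t [H zy yt tx]]]]]|].
  split_occurrence H; try (exfalso; lia); exists y, z, t => //.
  by split=> //; apply: subseq_trans H; apply: subseq_cons.
move=> [x [y [z [H yx xz]]]]; exists (m + k), x, y, z.
have := subseq_lt H => /= ?; split; [|lia..].
apply: subseq_trans (suffix_subseq _ _).
by rewrite /= eqxx.
Qed.

(** A single prefix letter followed by the maximum is an ascent, so for [k <= 1] only the 5 can come
    from outside [r]. For [k > 1] the letters [m.+1], [m] play 54. *)
Lemma occurs54213_prefix :
  occurs [:: 5; 4; 2; 1; 3] w =
  if k <= 1 then occurs [:: 4; 2; 1; 3] r else occurs [:: 2; 1; 3] r.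
Proof.
apply/occurs54213P/idP => [[v [x [y [z [t [H zy yt tx xv]]]]]]|].
  case: ifP => k_le1; [apply/occurs4213P | apply/occurs213P].
    split_occurrence H; try (exfalso; lia); exists x, y, z, t => //.
    by split=> //; apply: subseq_trans H; apply: subseq_cons.
  split_occurrence H; try (exfalso; lia); exists y, z, t => //; split=> //;
    apply: subseq_trans H => //.
  - exact: (suffix_subseq [:: x]).
  - exact: (suffix_subseq [:: v; x]).
  - exact: (suffix_subseq [:: x]).
case: ifP => k_le1.
  move=> /occurs4213P[x [y [z [t [H zy yt tx]]]]]; exists (m + k), x, y, z, t.
  have := subseq_lt H => /= ?; split; [|lia..].
  by apply: subseq_trans (suffix_subseq _ _); rewrite /= eqxx.
move=> /occurs213P[x [y [z [H yx xz]]]]; exists m.+1, m, x, y, z.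
have := subseq_lt H => /= ?; split; [|lia..].
rewrite /w -[[:: _, _ & _]]/([:: m.+1; m] ++ [:: x; y; z]).
apply: cat_subseq; last by apply: subseq_trans H (subseq_cons _ _).
by apply: subseq_rev_iota_start; rewrite ltnNge k_le1.
Qed.

End DecreasingPrefix.

(** * Splitting a word at its largest letter *)

(** Turns a ban on two-letter subsequences into sortedness, which then identifies the left part with
    an [iota] or its reverse. *)
Lemma sorted_subseq2 (T : eqType) (e : rel T) s :
  (forall x y, subseq [:: x; y] s -> e x y) -> sorted e s.
Proof.
elim: s => // x [|y s] IHs //= H; rewrite H /= ?eqxx ?sub0seq //=.
by apply: IHs => u v uv; apply: H; apply: subseq_trans uv (subseq_cons _ _).
Qed.

Section SplitAtMax.
Variables (n : nat) (l r : seq nat).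
Hypothesis perm_w : perm_eq (l ++ n :: r) (iota 0 n.+1).

Lemma split_size : size l + size r = n.
Proof. by have /= := perm_size perm_w; rewrite size_cat size_iota /=; lia. Qed.

Lemma split_mem x : [|| x \in l, x == n | x \in r] = (x <= n).
Proof. by have := perm_mem perm_w x; rewrite mem_cat inE mem_iota. Qed.

Lemma split_uniq :
  [/\ uniq l, uniq r, n \notin l, n \notin r & {in l, forall x, x \notin r}].
Proof.
have := iota_uniq 0 n.+1; rewrite -(perm_uniq perm_w) cat_uniq /=.
rewrite negb_or => /and3P[-> /andP[-> /hasPn rl] /andP[-> ->]]; split=> // x xl.
by apply/negP => /rl; rewrite /= xl.
Qed.

Lemma split_lt_l : {in l, forall x, x < n}.
Proof.
move=> x xl; have [_ _ nl _ _] := split_uniq.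
by rewrite ltn_neqAle -split_mem xl andbT; apply: contraNneq nl => <-.
Qed.

Lemma split_lt_r : {in r, forall x, x < n}.
Proof.
move=> x xr; have [_ _ _ nr _] := split_uniq.
by rewrite ltn_neqAle -split_mem xr !orbT andbT; apply: contraNneq nr => <-.
Qed.

(** Letters [x] in [l] and [y] in [r] with [x < y] would make [x n y] an occurrence of 132. *)
Lemma split_avoid132 :
  ~~ occurs [:: 1; 3; 2] (l ++ n :: r) -> {in l & r, forall x y, y < x}.
Proof.
move=> av x y xl yr; rewrite ltnNge; apply/negP => le_xy.
have [_ _ _ _ /(_ x xl) xr] := split_uniq.
have neq_xy : x != y by apply: contraNneq xr => ->.
case/negP: av; apply/occurs132P; exists x, n, y.
have := split_lt_r yr; split; [|lia..].
by apply: (@cat_subseq _ [:: x] [:: n; y]); rewrite ?sub1seq //= eqxx sub1seq.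
Qed.

(* An ascent xy to the left of the maximum n, followed by any letter z to the
   right of n, forms the pattern 2341, because z < x < y < n. *)
Lemma split_decreasing :
  r != [::] -> ~~ occurs [:: 1; 3; 2] (l ++ n :: r) ->
  ~~ occurs [:: 2; 3; 4; 1] (l ++ n :: r) ->
  l = rev (iota (size r) (size l)).
Proof.
move=> r_nil /split_avoid132 lr av.
have [ul ur nl nr l_r] := split_uniq.
(* [r] is closed downwards, since letters of [l] exceed those of [r]. So [z] in [r] puts [0, ..., z]
   in [r], whence [z < size r]. *)
have r_iota : r =i iota 0 (size r).
  apply: (uniq_min_size ur _ _).2; last by rewrite size_iota.
  move=> z zr; rewrite mem_iota /= add0n -(size_iota 0 z.+1).
  apply: uniq_leq_size => [|y]; first exact: iota_uniq.
  rewrite mem_iota => /= yz; have zn := split_lt_r zr.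
  have: y <= n by lia.
  rewrite -split_mem => /or3P[yl|/eqP yn|//]; last lia.
  by have := lr _ _ yl zr; lia.
have l_iota : l =i iota (size r) (size l).
  apply: (uniq_min_size ul _ _).2; last by rewrite size_iota.
  move=> x xl; have := split_lt_l xl; have := l_r _ xl.
  by rewrite r_iota !mem_iota; have := split_size; lia.
rewrite -[LHS]revK; congr rev.
apply: (irr_sorted_eq ltn_trans ltnn); rewrite ?iota_ltn_sorted //; last first.
  by move=> x; rewrite mem_rev l_iota.
rewrite rev_sorted; apply: sorted_subseq2 => x y xy /=.
case: r r_nil lr av => // z r' _ lr av.
have [xl yl] : x \in l /\ y \in l.
  by split; apply: (mem_subseq xy); rewrite !inE eqxx ?orbT.
have neq_xy : x != y by have := subseq_uniq xy ul; rewrite /= inE; case: eqP.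
rewrite ltnNge; apply/negP => le_xy; case/negP: av; apply/occurs2341P.
exists x, y, n, z; have := split_lt_l yl; have := lr _ z xl (mem_head _ _).
split; [|lia..].
by apply: (@cat_subseq _ [:: x; y] [:: n; z]) => //=; rewrite !eqxx sub0seq.
Qed.
End SplitAtMax.

Lemma perm_decreasing_prefix m k r :
  perm_eq (rev (iota m k) ++ (m + k) :: r) (iota 0 (m + k).+1) =
  perm_eq r (iota 0 m).
Proof.
have -> : iota 0 (m + k).+1 = iota 0 m ++ (iota m k ++ [:: m + k]).
  by rewrite -addnS iotaD add0n -(addn1 k) iotaD.
rewrite -cat1s catA.
have /permPl -> : perm_eq ((rev (iota m k) ++ [:: m + k]) ++ r)
                    (r ++ (iota m k ++ [:: m + k])).
  by rewrite perm_catC perm_cat2l perm_cat2r perm_rev.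
by rewrite perm_cat2r.
Qed.

Definition nwords n (P : pred (seq nat)) := count P (permutations (iota 0 n)).

(** Counts by the position of [n]. If [n] is last, the rest is counted by [P0]. Otherwise the left
    part is determined by its length [n - m], so only the right part, of length [m >= 1], is
    chosen. *)
Lemma nwords_rec n (P P0 : pred (seq nat)) (Q : nat -> pred (seq nat)) :
  (forall l, perm_eq (rcons l n) (iota 0 n.+1) -> P (rcons l n) = P0 l) ->
  (forall l r, perm_eq (l ++ n :: r) (iota 0 n.+1) -> r != [::] ->
     P (l ++ n :: r) = (l == rev (iota (size r) (size l))) && Q (size l) r) ->
  nwords n.+1 P = nwords n P0 + \sum_(1 <= m < n.+1) nwords m (Q (n - m)).
Proof.
move=> P_rcons P_split.
pose W m p := filter p (permutations (iota 0 m)).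
pose f m r := rev (iota m (n - m)) ++ n :: r.
have memW m p w : (w \in W m p) = p w && perm_eq w (iota 0 m).
  by rewrite mem_filter mem_permutations.
have uniqW m p : uniq (W m p) by rewrite filter_uniq ?permutations_uniq.
pose s1 := [seq rcons l n | l <- W n P0].
pose s2 := [seq f m r | m <- index_iota 1 n.+1, r <- W m (Q (n - m))].
have perm_rcons l : perm_eq (rcons l n) (iota 0 n.+1) = perm_eq l (iota 0 n).
  by rewrite -(addn1 n) iotaD -cats1 perm_cat2r.
have: perm_eq (W n.+1 P) (s1 ++ s2).
  apply: uniq_perm => [//||w].
    rewrite cat_uniq map_inj_uniq ?uniqW //=; last exact: rcons_injl.
    apply/andP; split.
      (* Disjointness: words in [s1] end with [n], words in [s2] with a letter of a nonempty [r],
         which is below [n]. *)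
      apply/hasPn => w /allpairsPdep[m [r [m_n]]].
      rewrite memW => /andP[_ perm_r] ->; apply/mapP => -[l _].
      case/lastP: r perm_r => [/perm_size|r x perm_r].
        by rewrite size_iota /=; move: m_n; rewrite mem_index_iota; lia.
      rewrite /f -rcons_cons -rcons_cat => /rcons_inj[_ xn].
      have := perm_mem perm_r x; rewrite mem_rcons mem_head mem_iota xn.
      by move: m_n; rewrite mem_index_iota; lia.
    apply: allpairs_uniq_dep => [|//|]; first exact: iota_uniq.
    move=> ? ? /allpairsPdep[m [r [m_n rW ->]]].
    move=> /allpairsPdep[m' [r' [m'_n r'W ->]]] /=.
    (* The position of [n] recovers [m], and then [r] is the remaining suffix; so distinct pairs
       give distinct words. *)
    have index_f k u : k \in index_iota 1 n.+1 -> index n (f k u) = n - k.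
      rewrite mem_index_iota => k_n; rewrite /f index_cat mem_rev mem_iota.
      by rewrite subnKC ?ltnn ?andbF /= ?eqxx ?addn0 ?size_rev ?size_iota; lia.
    move=> eq_f; have := congr1 (index n) eq_f; rewrite !index_f //.
    move: m_n m'_n; rewrite !mem_index_iota => m_n m'_n eq_m.
    have {eq_m} eq_m : m = m' by lia.
    by move: eq_f; rewrite -eq_m => /eqP; rewrite eqseq_cat // eqxx => /eqP[->].
  rewrite memW mem_cat; apply/andP/orP.
    case=> Pw perm_w; have: n \in w by rewrite (perm_mem perm_w) mem_iota leqnn.
    move=> /splitPr def_w; case: def_w Pw perm_w => l r Pw perm_w.
    have [r_nil|r_nil] := eqVneq r [::].
      left; rewrite r_nil cats1 in Pw perm_w *.
      apply/mapP; exists l => //.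
      by rewrite memW -perm_rcons perm_w andbT -P_rcons.
    right; move: Pw; rewrite P_split // => /andP[/eqP def_l Qr].
    have sz := split_size perm_w.
    apply/allpairsPdep; exists (size r), r; split.
    - by rewrite mem_index_iota lt0n size_eq0 r_nil ltnS -sz leq_addl.
    - rewrite memW (_ : n - size r = size l) ?Qr -?sz ?addnK //.
      by rewrite -(perm_decreasing_prefix _ (size l)) -def_l addnC sz.
    - by rewrite /f {1}def_l; congr (rev (iota _ _) ++ _); rewrite -sz addnK.
  case=> [/mapP[l]|/allpairsPdep[m [r [m_n]]]].
    rewrite memW => /andP[P0l perm_l] ->.
    by rewrite perm_rcons perm_l P_rcons // perm_rcons.
  rewrite memW => /andP[Qr perm_r] ->; move: m_n; rewrite mem_index_iota => m_n.
  have size_r : size r = m by rewrite (perm_size perm_r) size_iota.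
  have perm_f : perm_eq (f m r) (iota 0 n.+1).
    by have := perm_decreasing_prefix m (n - m) r; rewrite subnKC ?perm_r //; lia.
  split=> //; rewrite P_split // -?size_eq0 ?size_r ?size_rev ?size_iota; last lia.
  by rewrite eqxx.
move=> /perm_size; rewrite size_cat size_map size_allpairs_dep sumnE big_map.
by rewrite !size_filter /nwords => ->; congr (_ + _); apply: eq_bigr => m _;
   rewrite size_filter.
Qed.

(** * Recurrences for the three classes *)

Definition avoids (R : seq (seq nat)) (w : seq nat) : bool :=
  all (fun s => ~~ occurs s w) R.

Definition classA := avoids [:: [:: 1; 3; 2]; [:: 5; 4; 2; 1; 3]; [:: 2; 3; 4; 1]].
Definition classB := avoids [:: [:: 1; 3; 2]; [:: 4; 2; 1; 3]; [:: 2; 3; 4; 1]].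
Definition classC := avoids [:: [:: 1; 3; 2]; [:: 2; 1; 3]; [:: 2; 3; 4; 1]].

(** The three classes differ only in the middle pattern [s]; [q] abstracts its behaviour after a
    prefix of length [k], as computed above for each pattern. *)
Lemma avoids_split s (q : nat -> pred (seq nat)) n l r :
  (forall m k u, {in u, forall x, x < m} ->
     occurs s (rev (iota m k) ++ (m + k) :: u) = q k u) ->
  perm_eq (l ++ n :: r) (iota 0 n.+1) -> r != [::] ->
  avoids [:: [:: 1; 3; 2]; s; [:: 2; 3; 4; 1]] (l ++ n :: r) =
  (l == rev (iota (size r) (size l))) &&
  [&& ~~ occurs [:: 1; 3; 2] r, ~~ q (size l) r & ~~ occurs [:: 2; 3; 4; 1] r].
Proof.
move=> occ_s perm_w r_nil; rewrite /avoids /= andbT.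
have [def_l|neq_l] := eqVneq; last first.
  apply/negP => /and3P[av132 _ av2341].
  by rewrite -(split_decreasing perm_w) ?eqxx in neq_l.
have def_n : n = size r + size l by rewrite -(split_size perm_w) addnC.
have r_lt : {in r, forall x, x < size r}.
  move: perm_w; rewrite def_l def_n perm_decreasing_prefix.
  by move=> /perm_mem r_iota x; rewrite r_iota mem_iota.
have -> : l ++ n :: r = rev (iota (size r) (size l)) ++ (size r + size l) :: r.
  by rewrite -def_l -def_n.
by rewrite occurs132_prefix ?occ_s ?occurs2341_prefix.
Qed.

Lemma classC_rcons n l :
  perm_eq (rcons l n) (iota 0 n.+1) -> classC (rcons l n) = (l == iota 0 n).
Proof.
move=> perm_w; apply/idP/eqP => [/and4P[_ av _ _]|->].
  rewrite -cats1 in perm_w av.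
  have [ul _ _ _ _] := split_uniq perm_w; have l_lt := split_lt_l perm_w.
  apply: (irr_sorted_eq ltn_trans ltnn); rewrite ?iota_ltn_sorted //.
    apply: sorted_subseq2 => x y xy.
    have [xl yl] : x \in l /\ y \in l.
      by split; apply: (mem_subseq xy); rewrite !inE eqxx ?orbT.
    have neq_xy : x != y by have := subseq_uniq xy ul; rewrite /= inE; case: eqP.
    rewrite ltnNge; apply/negP => le_yx; case/negP: av; apply/occurs213P.
    exists x, y, n; have := l_lt _ xl; split; [|lia..].
    by apply: (@cat_subseq _ [:: x; y] [:: n]); rewrite ?sub1seq ?mem_head.
  apply/perm_mem; move: perm_w.
  by rewrite -(addn1 n) iotaD perm_cat2r.
have -> : rcons (iota 0 n) n = iota 0 n.+1 by rewrite -(addn1 n) iotaD cats1.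
have sub t : subseq t (iota 0 n.+1) -> sorted ltn t.
  by move=> t_n; apply: subseq_sorted t_n (iota_ltn_sorted _ _); apply: ltn_trans.
apply/and4P; split=> //.
- by apply/occurs132P => -[x [y [z [/sub /= + ? ?]]]]; lia.
- by apply/occurs213P => -[x [y [z [/sub /= + ? ?]]]]; lia.
- by apply/occurs2341P => -[x [y [z [t [/sub /= + ? ? ?]]]]]; lia.
Qed.

(** The 1 counts the increasing word, the only one with [n] last. A left part of length at least 2
    already creates 213, so at most the two longest right parts contribute. *)
Lemma nwordsC_rec n :
  nwords n.+1 classC =
  1 + \sum_(1 <= m < n.+1) (if n - m <= 1 then nwords m classC else 0).
Proof.
rewrite (@nwords_rec n _ (pred1 (iota 0 n)) (fun k w => (k <= 1) && classC w)).
- rewrite {1}/nwords count_uniq_mem ?permutations_uniq // mem_permutations.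
  rewrite perm_refl; congr (_ + _); apply: eq_bigr => m _.
  case: ifP => // _; exact: count_pred0.
- exact: classC_rcons.
- move=> l r perm_w r_nil.
  rewrite [LHS](avoids_split occurs213_prefix perm_w r_nil) /classC /avoids /=.
  by case: leqP; rewrite /= ?andbF ?andbT.
Qed.

Lemma nwordsB_rec n :
  nwords n.+1 classB =
  nwords n classB + \sum_(1 <= m < n.+1) nwords m classC.
Proof.
rewrite (@nwords_rec n _ classB (fun _ => classC)) // => [l|l r] perm_w.
  rewrite -cats1 in perm_w; have l_lt := split_lt_l perm_w.
  (* The letter exceeding the last one is the 3 of 132, at index 1, and the first letter in the
     other two patterns. *)
  by rewrite /classB /avoids /= (occurs_rcons_max (i := 1) l_lt)
             ?(occurs_rcons_max (i := 0) l_lt).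
move=> r_nil; have occ m k u := @occurs4213_prefix m k u.
rewrite [LHS](avoids_split (q := fun _ => occurs [:: 2; 1; 3]) occ perm_w r_nil).
by rewrite /classC /avoids /= andbT.
Qed.

Lemma nwordsA_rec n :
  nwords n.+1 classA =
  nwords n classA +
  \sum_(1 <= m < n.+1)
     (if n - m <= 1 then nwords m classB else nwords m classC).
Proof.
rewrite (@nwords_rec n _ classA (fun k => if k <= 1 then classB else classC)).
- by congr (_ + _); apply: eq_bigr => m _; case: ifP.
- move=> l perm_w; rewrite -cats1 in perm_w; have l_lt := split_lt_l perm_w.
  by rewrite /classA /avoids /= (occurs_rcons_max (i := 1) l_lt)
             ?(occurs_rcons_max (i := 0) l_lt).
move=> l r perm_w r_nil.
rewrite [LHS](avoids_split occurs54213_prefix perm_w r_nil).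
by case: leqP; rewrite /classB /classC /avoids /= ?andbT.
Qed.

(** * Initial values and closed forms *)

Lemma nwords0 R : all (fun s => 0 < size s) R -> nwords 0 (avoids R) = 1.
Proof.
move=> R_gt0; rewrite /nwords /= (_ : avoids R [::] = true) //.
apply/allP => s /(allP R_gt0) s_gt0; rewrite /occurs /= orbF /order_iso.
by case: s s_gt0.
Qed.

#[local] Arguments fib : simpl never.

Lemma fibSS n : fib n.+2 = fib n.+1 + fib n. Proof. by []. Qed.

Lemma nwordsC n : nwords n.+1 classC + 1 = fib n.+3.
Proof.
have c1 : nwords 1 classC = 1 by rewrite nwordsC_rec big_nil.
have cSS m : nwords m.+3 classC = 1 + nwords m.+1 classC + nwords m.+2 classC.
  rewrite nwordsC_rec 2?big_nat_recr //= subSnn subnn big_nat big1 ?add0n ?addnA //.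
  by move=> i i_m; case: ifP; lia.
suff [] : nwords n.+1 classC + 1 = fib n.+3 /\ nwords n.+2 classC + 1 = fib n.+4 by [].
elim: n => [|n [IH1 IH2]]; first by rewrite c1 nwordsC_rec big_nat1 /= c1.
by split=> //; rewrite cSS fibSS; lia.
Qed.

(** As in the other closed forms, subtracted terms are moved to the left, because subtraction on
    [nat] truncates. *)
Lemma sum_nwordsC n :
  \sum_(1 <= m < n.+1) nwords m classC + (n + 3) = fib n.+4.
Proof.
elim: n => [|n IHn]; first by rewrite big_nil.
by have := nwordsC n; rewrite big_nat_recr //= (fibSS n.+3); lia.
Qed.

Lemma nwordsB n : nwords n classB + ('C(n, 2) + 3 * n + 4) = fib n.+4.+1.
Proof.
elim: n => [|n IHn]; first by rewrite nwords0.
rewrite nwordsB_rec binS bin1; have := sum_nwordsC n.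
by rewrite (fibSS n.+4); lia.
Qed.

(** The closed form starts at length 2: at lengths 0 and 1 it would give -2 and 0, while both counts
    are 1. *)
Lemma nwordsA n :
  nwords n.+2 classA +
    (2 * 'C(n.+3, 3) + 4 * 'C(n.+3, 2) + 3 * n.+3 + 14) = 3 * fib n.+4.+3.
Proof.
elim: n => [//|n IHn].
rewrite nwordsA_rec 2?big_nat_recr //= subSnn subnn /=.
(* With the two [classB] summands split off, every remaining index has a left part of length at
   least 2. *)
rewrite (eq_big_nat _ _ (F2 := fun m => nwords m classC)); last first.
  by move=> i i_n; case: ifP; lia.
have := sum_nwordsC n; have := nwordsB n.+1; have := nwordsB n.+2; move: IHn.
by rewrite !binS !bin1 !bin0 !fibSS; lia.
Qed.

(** * Permutations as words *)

Definition word n (p : 'S_n) : seq nat := [seq val (p i) | i <- enum 'I_n].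

Lemma word_inj n : injective (@word n).
Proof.
move=> p q /eq_in_map pq; apply/permP => i; apply: val_inj.
by apply: pq; rewrite mem_enum.
Qed.

Lemma perm_word n (p : 'S_n) : perm_eq (word p) (iota 0 n).
Proof.
apply: uniq_perm; rewrite ?iota_uniq //.
  by rewrite map_inj_uniq ?enum_uniq // => i j /val_inj/perm_inj.
move=> x; rewrite mem_iota; apply/mapP/idP => [[i _ ->]|x_n].
  exact: ltn_ord.
by exists (p^-1%g (Ordinal x_n)); rewrite ?mem_enum // permKV.
Qed.

Lemma perm_words n :
  perm_eq [seq word p | p : 'S_n] (permutations (iota 0 n)).
Proof.
have u : uniq [seq word p | p : 'S_n].
  by rewrite map_inj_uniq ?enum_uniq //; apply: word_inj.
apply: uniq_perm; rewrite ?permutations_uniq //.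
(* Both lists are duplicate-free with [n]! entries, so one inclusion suffices. *)
apply: (uniq_min_size u _ _).2 => [w /mapP[p _ ->]|].
  by rewrite mem_permutations perm_word.
rewrite size_permutations ?iota_uniq // size_iota size_map -cardE.
by rewrite card_Sn.
Qed.

Lemma card_words n (P : pred (seq nat)) :
  #|[set p : 'S_n | P (word p)]| = nwords n P.
Proof.
rewrite /nwords -(seq.permP (perm_words n)) count_map cardsE cardE enumT.
by rewrite /enum_mem size_filter; apply: eq_count.
Qed.

Lemma sorted_enum_ord n : sorted (relpre val ltn) (enum 'I_n).
Proof. by rewrite -sorted_map val_enum_ord iota_ltn_sorted. Qed.

(** Strictly increasing maps into ['I_n] correspond to subsequences of [enum 'I_n]; the shift by one
    in [oneline] preserves comparisons. *)
Lemma contains_oneline n (p : 'S_n) w (perm_w : perm_eq w (iota 1 (size w))) :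
  contains p (oneline perm_w) = occurs w (word p).
Proof.
have ord_trans : transitive (relpre (val : 'I_n -> nat) ltn).
  by move=> ? ? ?; apply: ltn_trans.
have ord_irr : irreflexive (relpre (val : 'I_n -> nat) ltn).
  by move=> ? /=; apply: ltnn.
have ltW (a b : 'I_(size w)) :
    (oneline perm_w a < oneline perm_w b) = (nth 0 w a < nth 0 w b).
  by rewrite -!onelineE ltnS.
apply/existsP/occursP => [[f /andP[/forallP f_incr /forallP f_iso]]|].
  exists [seq val (p (f a)) | a <- enum 'I_(size w)].
    rewrite (map_comp (fun i => val (p i)) f); apply: map_subseq.
    (* A subsequence of a duplicate-free list is that list filtered by membership; here both sides
       are strictly increasing with the same elements. *)
    apply/(subseq_uniqP (enum_uniq _)).
    apply: (irr_sorted_eq ord_trans ord_irr).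
    - rewrite sorted_map; apply: sub_sorted (sorted_enum_ord _) => a b /= ab.
      by have /forallP /(_ b) /implyP := f_incr a; apply.
    - exact/sorted_filter/sorted_enum_ord.
    - by move=> i; rewrite mem_filter mem_enum andbT.
  apply/andP; split; first by rewrite size_map size_enum_ord.
  apply/allP => i; rewrite mem_iota /= add0n => i_w.
  apply/allP => j; rewrite mem_iota /= add0n => j_w.
  have nth_t k (k_w : k < size w) :
      nth 0 [seq val (p (f a)) | a <- enum 'I_(size w)] k = p (f (Ordinal k_w)).
    rewrite (nth_map (Ordinal k_w)) ?size_enum_ord //; congr (val (p (f _))).
    by apply: val_inj; rewrite /= nth_enum_ord.
  have /forallP /(_ (Ordinal j_w)) /eqP := f_iso (Ordinal i_w).
  by rewrite (nth_t i i_w) (nth_t j j_w) ltW => ->.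
move=> [_ /subseqP[b _ ->]]; rewrite /word -map_mask.
move: (mask_subseq b (enum 'I_n)); set t := mask _ _ => t_n.
move=> /andP[/eqP]; rewrite size_map => size_t /allP iso.
(* [t] lists the chosen positions in increasing order, and [f] enumerates them. *)
pose f a := tnth (in_tuple t) (cast_ord (esym size_t) a).
have nth_f x0 (a : 'I_(size w)) : f a = nth x0 t a by rewrite /f (tnth_nth x0).
exists (finfun f); apply/andP; split; apply/forallP => a; apply/forallP => c.
  apply/implyP => ac; rewrite !ffunE.
  have t_sorted := subseq_sorted ord_trans t_n (sorted_enum_ord n).
  have := sorted_ltn_nth ord_trans (f a) t_sorted => /(_ a c).
  by rewrite !inE size_t !ltn_ord /= -!nth_f; apply.
rewrite !ffunE ltW; have := iso a; rewrite mem_iota => /(_ (ltn_ord a)) /allP.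
move=> /(_ c); rewrite mem_iota => /(_ (ltn_ord c)).
by rewrite !(nth_map (f a)) ?size_t // -!nth_f.
Qed.

Lemma card_avoiders n :
  #|avoiders n [:: pat132; pat54213; pat2341]| = nwords n classA.
Proof.
have containsE (p : 'S_n) w (perm_w : perm_eq w (iota 1 (size w))) :
    contains p (tagged (pat perm_w)) = occurs w (word p).
  exact: contains_oneline.
rewrite -card_words; apply: eq_card => p; rewrite !inE.
by congr [&& ~~ _, ~~ _, ~~ _ & true]; apply: containsE.
Qed.

(** * The generating function *)

Local Open Scope ring_scope.

Section FormalSeries.
Variable R : comUnitRingType.
Implicit Types (f g h : fps R) (p q : {poly R}).

(** Coefficient [n] of a product depends only on coefficients up to [n], so ring laws transfer from
    truncated polynomials to series. *)
Lemma fps_mul_polyE f g p q n :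
  (forall i, (i <= n)%N -> f i = p`_i) -> (forall i, (i <= n)%N -> g i = q`_i) ->
  fps_mul f g n = (p * q)`_n.
Proof.
move=> fp gq; rewrite coefM; apply: eq_bigr => i _.
by rewrite fp ?gq ?leq_subr // -ltnS.
Qed.

Lemma eq_fps_mul f f' g g' : f =1 f' -> g =1 g' -> fps_mul f g =1 fps_mul f' g'.
Proof. by move=> ff' gg' n; apply: eq_bigr => i _; rewrite ff' gg'. Qed.

Lemma fps_mulA f g h : fps_mul (fps_mul f g) h =1 fps_mul f (fps_mul g h).
Proof.
move=> n; pose t k (u : fps R) := \poly_(i < k.+1) u i.
have tE u i : (i <= n)%N -> u i = (t n u)`_i by rewrite coef_poly ltnS => ->.
rewrite (@fps_mul_polyE _ _ (t n f * t n g) (t n h)); [|move=> i i_n..].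
- rewrite (@fps_mul_polyE _ _ (t n f) (t n g * t n h)) ?mulrA // => i i_n.
    exact: tE.
  by apply: fps_mul_polyE => j j_i; apply: tE; apply: leq_trans i_n.
- by apply: fps_mul_polyE => j j_i; apply: tE; apply: leq_trans i_n.
- exact: tE.
Qed.

Lemma fps_mul1 f : fps_mul f (fps_of_poly 1) =1 f.
Proof.
move=> n; rewrite (@fps_mul_polyE _ _ (\poly_(i < n.+1) f i) 1) //.
  by rewrite mulr1 coef_poly ltnSn.
by move=> i i_n; rewrite coef_poly ltnS i_n.
Qed.

Lemma fps_divP f g h :
  g 0%N \is a GRing.unit -> fps_mul f g =1 h -> f =1 fps_div h g.
Proof.
move=> Ug fg n; rewrite /fps_div -(eq_fps_mul fg (frefl _)) fps_mulA.
by rewrite (eq_fps_mul (frefl f) (fps_mulV Ug)) fps_mul1.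
Qed.

End FormalSeries.

(** Expanded coefficients, constant term first. *)
Definition denominator : seq rat := [:: -1; 5; -9; 6; 1; -3; 1].
Definition numerator : seq rat := [:: -1; 4; -6; 2; 1; -3; 0; 1].

Lemma denominatorE :
  ('X^2 + 'X - 1) * (1 - 'X) ^+ 4 = Poly denominator :> {poly rat}.
Proof. by rewrite /= !cons_poly_def; ring. Qed.

Lemma numeratorE :
  'X^7 - 3 * 'X^5 + 'X^4 + 2 * 'X^3 - 6 * 'X^2 + 4 * 'X - 1
  = Poly numerator :> {poly rat}.
Proof. rewrite /= !cons_poly_def; ring. Qed.

Lemma fps_mul_denominator (u : fps rat) n :
  fps_mul u (fps_of_poly (Poly denominator)) n.+4.+4 =
  - u n.+4.+4 + 5 * u n.+4.+3 - 9 * u n.+4.+2 + 6 * u n.+4.+1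
  + u n.+4 - 3 * u n.+3 + u n.+2.
Proof.
rewrite /fps_mul (reindex_inj rev_ord_inj) /fps_of_poly.
under eq_bigr => i _ do rewrite coef_Poly /= subSS subKn -1?ltnS //.
rewrite 7!big_ord_recl big1 => [|i _]; last by rewrite nth_default ?mulr0.
by rewrite /= /bump !subSS !subn0 /=; ring.
Qed.

(** The factor of degree 2 in the denominator annihilates the Fibonacci term and [(1 - 'X) ^+ 4] the
    cubic polynomial term. The lowest index is [n.+2], so the closed form covers all seven
    counts. *)
Lemma nwordsA_linear_rec n :
  (nwords n.+4.+4 classA + 9 * nwords n.+4.+2 classA + 3 * nwords n.+3 classA =
   5 * nwords n.+4.+3 classA + 6 * nwords n.+4.+1 classA + nwords n.+4 classA
   + nwords n.+2 classA)%N.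
Proof.
move: (nwordsA n) (nwordsA n.+1) (nwordsA n.+2) (nwordsA n.+3) (nwordsA n.+4).
move: (nwordsA n.+4.+1) (nwordsA n.+4.+2).
by rewrite !binS !bin1 !bin0 !fibSS; lia.
Qed.

Lemma nwordsA_numerator :
  fps_mul (fun n => (nwords n classA)%:R) (fps_of_poly (Poly denominator))
  =1 fps_of_poly (Poly numerator).
Proof.
(* The numerator has degree 7: from 8 on its coefficients vanish and the linear recurrence applies.
   Smaller coefficients are checked individually. *)
move=> n; have [n_lt8|] := ltnP n 8; last first.
  case: n => [|[|[|[|[|[|[|[|n]]]]]]]] // _.
  rewrite fps_mul_denominator /fps_of_poly coef_Poly nth_default //.
  have := congr1 (fun k => k%:R : rat) (nwordsA_linear_rec n).
  by rewrite !(natrM, natrD); lra.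
(* Lengths 0 and 1 lie outside the closed form and are evaluated directly; the later values are read
   off it. *)
have [a0 a1] : nwords 0 classA = 1%N /\ nwords 1 classA = 1%N by [].
have aE k v : (3 * fib k.+4.+3 = v +
    (2 * 'C(k.+3, 3) + 4 * 'C(k.+3, 2) + 3 * k.+3 + 14))%N ->
    nwords k.+2 classA = v by have := nwordsA k; lia.
have a2 : nwords 2 classA = 2%N by apply: aE.
have a3 : nwords 3 classA = 5%N by apply: aE.
have a4 : nwords 4 classA = 13%N by apply: aE.
have a5 : nwords 5 classA = 33%N by apply: aE.
have a6 : nwords 6 classA = 78%N by apply: aE.
have a7 : nwords 7 classA = 170%N by apply: aE.
case: n n_lt8 => [|[|[|[|[|[|[|[|n]]]]]]]] n_lt8; last by [].
all: rewrite /fps_mul /fps_of_poly !big_ord_recr big_ord0 !coef_Poly /=.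
all: by rewrite ?subSS ?subn0 ?a0 ?a1 ?a2 ?a3 ?a4 ?a5 ?a6 ?a7; ring.
Qed.

Theorem theorem4p11 :
  (forall n : nat, (2 <= n)%N ->
     #|avoiders n [:: pat132; pat54213; pat2341]|%:Z =
        3 * (fib (n + 5))%:Z - 2 * 'C(n + 1, 3)%:Z - 4 * 'C(n + 1, 2)%:Z
        - 3 * 'C(n + 1, 1)%:Z - 14)
  /\
  ((fun n : nat => #|avoiders n [:: pat132; pat54213; pat2341]|%:R) : fps rat) =1
    fps_div
      (fps_of_poly ('X^7 - 3 * 'X^5 + 'X^4 + 2 * 'X^3 - 6 * 'X^2 + 4 * 'X - 1))
      (fps_of_poly (('X^2 + 'X - 1) * (1 - 'X) ^+ 4)).
Proof.
split=> [[|[|n]] // _|].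
  have := nwordsA n; rewrite card_avoiders addn1 bin1.
  by rewrite (_ : (n.+2 + 5 = n.+4.+3)%N); lia.
rewrite numeratorE denominatorE; apply: fps_divP.
  by rewrite /fps_of_poly coef_Poly.
apply: ftrans nwordsA_numerator; apply: eq_fps_mul => // n.
by rewrite card_avoiders.
Qed.
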